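(* Let $(R,\mathfrak m,k)$ be a commutative noetherian local ring, and let $\phi\colon F\to M$ be an irreducible epimorphism of finitely generated $R$-modules with $F$ free. Then the following assertions hold. (a) The kernel of $\phi$ is isomorphic to $k$. (b) Assume that $\operatorname{End}_R(M)$ is a local ring, and let $\iota\colon R\to F$ be a split monomorphism. Then the following hold. (b1) The composition $\phi\iota\colon R\to M$ is irreducible and hence it is either surjective or injective. (b2) Suppose that $\phi\iota$ is surjective. Then $R$ has type one, $F$ has rank one, and, with $\pi\colon R\to R/\operatorname{Soc}R$ the natural surjection, there is a homomorphism $\rho\colon R/\operatorname{Soc}R\to M$ such that $\phi\iota=\rho\pi$ and both $\iota$ and $\rho$ are isomorphisms.
   Context: All modules are finitely generated. A homomorphism $f\colon M\to N$ of finitely generated $R$-modules is called irreducible if $f$ is neither a split monomorphism nor a split epimorphism, and for every factorization $f=hg$ with $g\colon M\to L$, $h\colon L\to N$ homomorphisms and $L$ a finitely generated $R$-module, either $g$ is a split monomorphism or $h$ is a split epimorphism. An irreducible epimorphism is an irreducible homomorphism that is surjective. $\operatorname{Soc}R=\{r\in R : \mathfrak m r=0\}$ is the socle of $R$. The type of $R$ is $\dim_k\operatorname{Ext}^{t}_R(k,R)$ with $t=\operatorname{depth}R$. The ring $\operatorname{End}_R(M)$ is possibly noncommutative; local means that its non-units form a two-sided ideal. *)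

(* Defs.v *)
From HB Require Import structures.
From mathcomp Require Import all_boot all_algebra.
From mathcomp Require Import boolp.
From mathcomp Require Import freeg.

Set Implicit Arguments.
Unset Strict Implicit.
Unset Printing Implicit Defensive.

Import GRing.Theory.
Local Open Scope ring_scope.
Local Open Scope quotient_scope.

Section SubQuotient.
Variables (R : pzRingType) (V : lmodType R) (S : submodClosed V).

Record submod := Submod { submod_val : V; submod_valP : submod_val \in S }.

HB.instance Definition _ := [isSub for submod_val].
HB.instance Definition _ := [Choice of submod by <:].
HB.instance Definition _ := [SubChoice_isSubLmodule of submod by <:].

(* A submodClosed predicate carries no zmodClosed structure in MathComp, which
   is what Quotient.quot expects. *)
Definition zmod_of_submod : V -> bool := fun x => x \in S.
Fact zmod_of_submod_closed : zmod_closed zmod_of_submod.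
Proof. exact: GRing.submod_closedB (submodClosedP S). Qed.
HB.instance Definition _ :=
  GRing.isZmodClosed.Build V zmod_of_submod zmod_of_submod_closed.

Let zmodS : zmodClosed V := GRing.ZmodClosed.clone V zmod_of_submod _.
Definition quotmod := Quotient.quot zmodS.
HB.instance Definition _ := GRing.Zmodule.on quotmod.

Definition quotproj (x : V) : quotmod := \pi_(Quotient.quot zmodS) x.

Lemma eq_quotproj (x y : V) : quotproj x = quotproj y <-> x - y \in S.
Proof.
have e : (x - y \in S) = (x == y %[mod Quotient.quot zmodS]).
  exact: (Quotient.idealrBE zmodS).
by rewrite e; split=> /eqP.
Qed.

Lemma quotprojD : {morph quotproj : x y / x + y}.
Proof. exact: (raddfD \pi_(Quotient.quot zmodS)). Qed.

Definition quotrepr (x : quotmod) : V := repr (x : Quotient.quot zmodS).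

Lemma quotreprK : cancel quotrepr quotproj.
Proof. by move=> x; exact: (@reprK _ (Quotient.quot zmodS)). Qed.

Definition quotscale (a : R) (x : quotmod) : quotmod :=
  quotproj (a *: quotrepr x).

Lemma quotprojZ a x : quotscale a (quotproj x) = quotproj (a *: x).
Proof.
apply/eq_quotproj; rewrite -scalerBr rpredZ //.
by apply/eq_quotproj; rewrite quotreprK.
Qed.

Fact quotscaleA a b x : quotscale a (quotscale b x) = quotscale (a * b) x.
Proof. by rewrite -[x]quotreprK !quotprojZ scalerA. Qed.

Fact quotscale1 : left_id 1 quotscale.
Proof. by move=> x; rewrite -[x]quotreprK quotprojZ scale1r. Qed.

Fact quotscaleDr : right_distributive quotscale +%R.
Proof.
move=> a x y; rewrite -[x]quotreprK -[y]quotreprK -quotprojD !quotprojZ.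
by rewrite scalerDr quotprojD.
Qed.

Fact quotscaleDl x : {morph quotscale^~ x : a b / a + b}.
Proof.
by move=> a b; rewrite -[x]quotreprK !quotprojZ scalerDl quotprojD.
Qed.

HB.instance Definition _ := GRing.Zmodule_isLmodule.Build R quotmod
  quotscaleA quotscale1 quotscaleDr quotscaleDl.

Fact quotproj_is_linear : linear quotproj.
Proof. by move=> a x y; rewrite quotprojD -quotprojZ. Qed.
HB.instance Definition _ :=
  GRing.isLinear.Build R V quotmod *:%R quotproj quotproj_is_linear.
End SubQuotient.

Section Kernel.
Variables (R : pzRingType) (V W : lmodType R) (f : {linear V -> W}).

Definition kermod_pred : V -> bool := fun x => f x == 0.
Fact kermod_submod : submod_closed kermod_pred.
Proof.
split=> [|a x y]; rewrite /kermod_pred !unfold_in ?linear0 // => /eqP fx /eqP fy.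
by rewrite linearP fx fy scaler0 addr0.
Qed.
HB.instance Definition _ := GRing.isSubmodClosed.Build R V kermod_pred kermod_submod.
Definition kermod : submodClosed V := GRing.SubmodClosed.clone R V kermod_pred _.
End Kernel.

Section Hom.
Variables (R : comNzRingType) (U V : lmodType R).
Local Notation hom := {linear U -> V}.

HB.instance Definition _ := gen_eqMixin hom.
HB.instance Definition _ := gen_choiceMixin hom.

Lemma hom_ext (f g : hom) : f =1 g -> f = g.
Proof.
case: f g => [f [[a] [b]]] [g [[a'] [b']]] /= /funext fg.
move: a b a' b'; rewrite fg => a b a' b'.
by rewrite (Prop_irrelevance a a') (Prop_irrelevance b b').
Qed.

Definition hom_add (f g : hom) : hom := f \+ g.
Definition hom_opp (f : hom) : hom := \- f.
Definition hom_scale (a : R) (f : hom) : hom := a \*: f.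

Fact hom_addA : associative hom_add.
Proof. by move=> f g h; apply: hom_ext => x /=; rewrite addrA. Qed.
Fact hom_addC : commutative hom_add.
Proof. by move=> f g; apply: hom_ext => x /=; rewrite addrC. Qed.
Fact hom_add0 : left_id (\0 : hom) hom_add.
Proof. by move=> f; apply: hom_ext => x /=; rewrite add0r. Qed.
Fact hom_addN : left_inverse (\0 : hom) hom_opp hom_add.
Proof. by move=> f; apply: hom_ext => x /=; rewrite addNr. Qed.
HB.instance Definition _ :=
  GRing.isZmodule.Build hom hom_addA hom_addC hom_add0 hom_addN.

Fact hom_scaleA a b f : hom_scale a (hom_scale b f) = hom_scale (a * b) f.
Proof. by apply: hom_ext => x /=; rewrite scalerA. Qed.
Fact hom_scale1 : left_id 1 hom_scale.
Proof. by move=> f; apply: hom_ext => x /=; rewrite scale1r. Qed.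
Fact hom_scaleDr : right_distributive hom_scale +%R.
Proof. by move=> a f g; apply: hom_ext => x /=; rewrite scalerDr. Qed.
Fact hom_scaleDl f : {morph hom_scale^~ f : a b / a + b}.
Proof. by move=> a b; apply: hom_ext => x /=; rewrite scalerDl. Qed.
HB.instance Definition _ := GRing.Zmodule_isLmodule.Build R hom
  hom_scaleA hom_scale1 hom_scaleDr hom_scaleDl.
End Hom.

Section End.
Variables (R : comNzRingType) (M : lmodType R).

Definition endo := {linear M -> M}.
HB.instance Definition _ := GRing.Zmodule.on endo.

Definition endo_one : endo := idfun.
Definition endo_mul (f g : endo) : endo := f \o g.

Fact endo_mulA : associative endo_mul.
Proof. by move=> f g h; apply: hom_ext. Qed.
Fact endo_mul1l : left_id endo_one endo_mul.
Proof. by move=> f; apply: hom_ext. Qed.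
Fact endo_mul1r : right_id endo_one endo_mul.
Proof. by move=> f; apply: hom_ext. Qed.
Fact endo_mulDl : left_distributive endo_mul +%R.
Proof. by move=> f g h; apply: hom_ext. Qed.
Fact endo_mulDr : right_distributive endo_mul +%R.
Proof. by move=> f g h; apply: hom_ext => x /=; exact: linearD. Qed.
HB.instance Definition _ := GRing.Zmodule_isPzRing.Build endo
  endo_mulA endo_mul1l endo_mul1r endo_mulDl endo_mulDr.
End End.

Definition is_unit (A : pzRingType) (x : A) : Prop :=
  exists y, x * y = 1 /\ y * x = 1.

(* The non-units form a two-sided ideal; A need not be commutative. *)
Definition local_ring (A : pzRingType) : Prop :=
  [/\ ~ is_unit (0 : A),
      forall x y : A, ~ is_unit x -> ~ is_unit y -> ~ is_unit (x - y)
    & forall a x : A, ~ is_unit x -> ~ is_unit (a * x) /\ ~ is_unit (x * a)].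

Section Modules.
Variable R : comNzRingType.

Definition isomorphic (U V : lmodType R) : Prop :=
  exists f : {linear U -> V}, bijective f.

Definition finitely_generated (V : lmodType R) : Prop :=
  exists n (e : 'I_n -> V), forall x, exists c : 'I_n -> R,
    x = \sum_i c i *: e i.

Definition free_of_rank (V : lmodType R) (n : nat) : Prop :=
  isomorphic V 'rV[R]_n.

Definition free_module (V : lmodType R) : Prop :=
  exists I : choiceType, isomorphic V {freeg I / R}.

Definition noetherian : Prop :=
  forall I : submodClosed R^o, finitely_generated (submod I).

Definition maximal_ideal (I : submodClosed R^o) : Prop :=
  1 \notin I /\
  forall J : submodClosed R^o, 1 \notin J -> {subset I <= J} -> J =i I.

Definition unique_maximal_ideal (m : submodClosed R^o) : Prop :=
  maximal_ideal m /\ forall I : submodClosed R^o, maximal_ideal I -> I =i m.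

(* R is a noetherian local ring, with maximal ideal m. *)
Definition noetherian_local (m : submodClosed R^o) : Prop :=
  noetherian /\ unique_maximal_ideal m.

Definition split_mono (U V : lmodType R) (f : {linear U -> V}) : Prop :=
  exists r : {linear V -> U}, cancel f r.

Definition split_epi (U V : lmodType R) (f : {linear U -> V}) : Prop :=
  exists s : {linear V -> U}, cancel s f.

Definition irreducible (M N : lmodType R) (f : {linear M -> N}) : Prop :=
  [/\ ~ split_mono f, ~ split_epi f
    & forall (L : lmodType R) (g : {linear M -> L}) (h : {linear L -> N}),
        finitely_generated L -> f =1 h \o g -> split_mono g \/ split_epi h].

Definition surjective_map (U V : lmodType R) (f : {linear U -> V}) : Prop :=
  forall y, exists x, f x = y.

End Modules.

Section Resolution.
Variable R : comNzRingType.
Implicit Types V : lmodType R.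

(* The canonical surjection onto V from the free module on the set V. *)
Definition augm V : {freeg V / R} -> V := fglift (@idfun V).

Fact augm_is_zmod_morphism V : zmod_morphism (@augm V).
Proof. exact: lift_is_additive. Qed.
HB.instance Definition _ V := GRing.isZmodMorphism.Build {freeg V / R} V
  (@augm V) (@augm_is_zmod_morphism V).

Lemma augmU V a x : augm << a *g x >> = a *: x :> V.
Proof. exact: liftU. Qed.

Fact augm_is_scalable V : scalable (@augm V).
Proof.
move=> a D; rewrite -[in RHS](freeg_sumE D) !raddf_sum.
by apply: eq_bigr => x _; rewrite /= !augmU scalerA.
Qed.
HB.instance Definition _ V :=
  GRing.isScalable.Build R {freeg V / R} V *:%R (@augm V) (@augm_is_scalable V).

Fixpoint syzygy V (n : nat) : lmodType R :=
  if n is n'.+1 then submod (kermod (@augm (syzygy V n'))) else V.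

(* The free resolution ... -> free_res V 1 -> free_res V 0 -> V -> 0. *)
Definition free_res V n : lmodType R := {freeg (syzygy V n) / R}.

Definition free_res_diff V n : {linear free_res V n.+1 -> free_res V n} :=
  val \o @augm (syzygy V n.+1).

Lemma augm_surj V x : exists D, @augm V D = x.
Proof. by exists << x >>; rewrite augmU scale1r. Qed.

Lemma augm_exact V (x : free_res V 0) :
  augm x = 0 <-> exists y, free_res_diff V 0 y = x.
Proof.
split=> [x0|[y <-]]; last by apply/eqP; exact: (valP (augm y)).
have kx : x \in kermod (@augm V) by apply/eqP.
have [y yx] := augm_surj (Submod kx : syzygy V 1).
by exists y; rewrite /= yx.
Qed.

Lemma free_res_exact V n (x : free_res V n.+1) :
  free_res_diff V n x = 0 <-> exists y, free_res_diff V n.+1 y = x.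
Proof.
split=> [x0|[y <-]].
  have kx : x \in kermod (@augm (syzygy V n.+1)) by apply/eqP/val_inj; exact: x0.
  have [y yx] := augm_surj (Submod kx : syzygy V n.+2).
  by exists y; rewrite /= yx.
have /eqP y0 := valP (augm y).
exact: (congr1 (@submod_val _ _ _) y0).
Qed.

Variables U N : lmodType R.
Local Notation cochain n := {linear free_res U n -> N}.

Definition codiff n (f : cochain n) : cochain n.+1 := f \o @free_res_diff U n.

Fact codiff_is_linear n : linear (@codiff n).
Proof. by move=> a f g; apply: hom_ext => x. Qed.
HB.instance Definition _ n := GRing.isLinear.Build R (cochain n) (cochain n.+1)
  *:%R (@codiff n) (@codiff_is_linear n).

Definition cocycle n : lmodType R := submod (kermod (@codiff n)).

Definition coboundary_pred n : cocycle n -> bool :=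
  match n with
  | 0 => fun z => z == 0
  | n'.+1 => fun z => `[< exists g, codiff g = val z :> cochain n'.+1 >]
  end.

Fact coboundary_submod n : submod_closed (@coboundary_pred n).
Proof.
case: n => [|n]; split; rewrite ?unfold_in //=.
- by move=> a x y; rewrite !unfold_in => /eqP-> /eqP->; rewrite scaler0 addr0.
- by apply/asboolP; exists 0; rewrite linear0.
- move=> a x y; rewrite !unfold_in => /asboolP[f fx] /asboolP[g gy].
  by apply/asboolP; exists (a *: f + g); rewrite linearP; congr (_ *: _ + _).
Qed.
HB.instance Definition _ n :=
  GRing.isSubmodClosed.Build R (cocycle n) (@coboundary_pred n)
    (@coboundary_submod n).
Definition coboundary n : submodClosed (cocycle n) :=
  GRing.SubmodClosed.clone R (cocycle n) (@coboundary_pred n) _.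

(* Ext^n_R(U, N), the n-th cohomology of Hom_R(free_res U, N). *)
Definition Ext n : lmodType R := quotmod (@coboundary n).
End Resolution.

Section LocalInvariants.
Variables (R : comNzRingType) (m : submodClosed R^o).

Definition residue_field : lmodType R := quotmod m.

(* dim_k V = n, for V annihilated by m: the k-linear maps between such modules
   are the R-linear ones, so that V has dimension n exactly when V is isomorphic
   to k^n over R.  This applies to V = Ext^t_R(k, R), which m annihilates. *)
Definition has_residue_dim (V : lmodType R) (n : nat) : Prop :=
  isomorphic V {ffun 'I_n -> residue_field}.

Definition soc_pred : R^o -> bool :=
  fun r => `[< forall a : R, a \in m -> a * r = 0 >].
Fact soc_submod : submod_closed soc_pred.
Proof.
split=> [|a x y]; rewrite !unfold_in; first by apply/asboolP => b _; rewrite mulr0.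
move=> /asboolP x0 /asboolP y0; apply/asboolP => b bm.
by rewrite mulrDr y0 // /GRing.scale /= mulrCA x0 // mulr0 addr0.
Qed.
HB.instance Definition _ := GRing.isSubmodClosed.Build R R^o soc_pred soc_submod.
Definition Soc : submodClosed R^o := GRing.SubmodClosed.clone R R^o soc_pred _.

(* x belongs to the ideal generated by the elements of s *)
Definition in_ideal (s : seq R) (x : R) : Prop :=
  exists c : nat -> R, x = \sum_(i < size s) c i * s`_i.

Definition regular_seq (s : seq R) : Prop :=
  ~ in_ideal s 1 /\
  forall i, (i < size s)%N ->
    forall a, in_ideal (take i s) (s`_i * a) -> in_ideal (take i s) a.

(* depth R = t, the maximal length of a regular sequence in m *)
Definition has_depth (t : nat) : Prop :=
  (exists s : seq R, [/\ size s = t, {subset s <= m} & regular_seq s]) /\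
  (forall s : seq R, {subset s <= m} -> regular_seq s -> (size s <= t)%N).

Definition has_type (n : nat) : Prop :=
  exists t, has_depth t /\ has_residue_dim (Ext residue_field R^o t) n.
End LocalInvariants.

(* Main.v *)
Require Import Defs.
From mathcomp Require Import all_boot all_algebra.
From HB Require Import structures.
From mathcomp Require Import freeg boolp classical_sets.
Import GRing.Theory.
Local Open Scope ring_scope.

Set Implicit Arguments.
Unset Strict Implicit.
Unset Printing Implicit Defensive.

(** Let [K] be the kernel of [phi : F -> M].

    (a) No linear functional on [F] takes a unit value on [K]: a vector of [K]
    with a unit coordinate spans a summand of [F], and projecting that summand
    away factors [phi] through a complement, against irreducibility
    ([functional_on_kernel_in_max]).  As [F] is free this says that [K] lies in
    [m F], so by Nakayama a submodule [N] with [N + K = F] is all of [F]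
    ([kernel_superfluous]).  Now let [S] be a nonzero submodule of [K] and factor
    [phi] through [F / S].  The projection [F -> F / S] is not injective, so
    [F / S -> M] has a section [s].  The projection and [s phi] agree on a
    submodule that together with [K] fills [F], hence they agree everywhere; on
    [K] the second one vanishes, so [K] lies in [S]
    ([kernel_no_proper_submod]).  Thus [K] is a simple module, that is [k].

    (b1) Complete [iota] to a decomposition of [F].  A factorization of
    [phi iota] through [L] gives one of [phi] through the sum of [L] and the
    complement; if the second factor of the latter splits, the identity of [M]
    is a sum of two endomorphisms, one of which is invertible because [End M] is
    local ([irreducible_restrict_summand]).  An irreducible map is surjective or
    injective because it factors through its image.

    (b2) If [psi = phi iota] is surjective then [iota R + K = F], so [iota] is
    surjective by [kernel_superfluous] and [F] is isomorphic to [R].  By the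
    argument for (a), the kernel of [psi] is generated by one element [a] with
    annihilator [m]; in particular [a] is a socle element.  Any socle element [x]
    is a multiple of [a]: otherwise [a |-> x] could neither be extended to [R]
    nor be undone by an endomorphism of [R], and the pushout
    [(R x R) / R (a, - x)] would be a forbidden factorization of [psi]
    ([socle_sub_kernel]).  So the kernel of [psi] is [Soc R], which gives [rho].
    Finally [a] is a nonzero element killed by [m], so the depth is zero, and
    [Ext^0(k, R) = Hom(k, R)] is the socle, which is one-dimensional. *)

(** * Linear maps, submodules and quotients *)

Section LinearMaps.
Variable R : comNzRingType.
Implicit Types U V W : lmodType R.

Definition mklinear U V (f : U -> V) (lf : linear f) : {linear U -> V} :=
  HB.pack f (GRing.isLinear.Build R U V *:%R f lf).

Lemma mksubmod_closed V (P : V -> Prop) :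
  P 0 -> (forall a x y, P x -> P y -> P (a *: x + y)) ->
  submod_closed (fun x : V => `[< P x >]).
Proof.
move=> P0 PD; split=> [|a x y]; rewrite !unfold_in; first exact/asboolP.
by move=> /asboolP Px /asboolP Py; apply/asboolP/PD.
Qed.

(** Membership predicates of submodules are Boolean; this turns a propositional
    one into a submodule by classical decidability. *)
Definition mksubmod V (P : V -> Prop) (P0 : P 0)
    (PD : forall a x y, P x -> P y -> P (a *: x + y)) : submodClosed V :=
  HB.pack (fun x : V => `[< P x >])
    (GRing.isSubmodClosed.Build R V _ (mksubmod_closed P0 PD)).

Lemma mksubmodE V P P0 PD (x : V) : reflect (P x) (x \in @mksubmod V P P0 PD).
Proof. exact: asboolP. Qed.

Definition range_mod U V (f : {linear U -> V}) : submodClosed V.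
Proof.
apply: (@mksubmod V (fun y => exists x, f x = y)).
  by exists 0; rewrite linear0.
by move=> a _ _ [x <-] [y <-]; exists (a *: x + y); rewrite linearP.
Defined.

Lemma range_modP U V (f : {linear U -> V}) y :
  reflect (exists x, f x = y) (y \in range_mod f).
Proof. exact: asboolP. Qed.

Fact scale_by_is_linear V (v : V) : linear (fun r : R^o => r *: v).
Proof. by move=> a x y; rewrite scalerDl scalerA. Qed.

Definition scale_by V (v : V) : {linear R^o -> V} :=
  mklinear (scale_by_is_linear v).

Lemma kermodE U V (f : {linear U -> V}) x : (x \in kermod f) = (f x == 0).
Proof. by []. Qed.

Lemma kermodP U V (f : {linear U -> V}) x :
  reflect (f x = 0) (x \in kermod f).
Proof. exact: eqP. Qed.

Fact corestrict_is_linear U V (f : {linear U -> V}) (S : submodClosed V)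
  (fS : forall x, f x \in S) : linear (fun x => Submod (fS x)).
Proof. by move=> a x y; apply: val_inj; rewrite /= linearP. Qed.

Definition corestrict U V (f : {linear U -> V}) (S : submodClosed V)
    (fS : forall x, f x \in S) : {linear U -> submod S} :=
  mklinear (corestrict_is_linear fS).

Lemma quotproj_eq0 V (S : submodClosed V) x :
  quotproj S x = 0 <-> x \in S.
Proof. by rewrite -(linear0 (quotproj S)) eq_quotproj subr0. Qed.

Lemma quotproj_surj V (S : submodClosed V) : surjective_map (quotproj S).
Proof. by move=> y; exists (quotrepr y); exact: quotreprK. Qed.

Lemma lin_injP U V (f : {linear U -> V}) :
  (forall x, f x = 0 -> x = 0) -> injective f.
Proof.
move=> f0 x y fxy; apply/eqP; rewrite -subr_eq0; apply/eqP/f0.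
by rewrite linearB fxy subrr.
Qed.

Lemma inj_surj_bijective U V (f : {linear U -> V}) :
  injective f -> surjective_map f -> bijective f.
Proof.
move=> fI /choice[g fg]; exists g => // x; exact/fI/fg.
Qed.

Lemma inv_is_linear U V (f : {linear U -> V}) g :
  cancel f g -> cancel g f -> linear g.
Proof. by move=> fK gK a x y; rewrite -[x in LHS]gK -[y in LHS]gK -linearP fK. Qed.

Lemma isomorphic_sym U V : isomorphic U V -> isomorphic V U.
Proof.
by move=> [f [g fK gK]]; exists (mklinear (inv_is_linear fK gK)); exists f.
Qed.

Lemma isomorphic_trans U V W :
  isomorphic U V -> isomorphic V W -> isomorphic U W.
Proof. by move=> [f fb] [g gb]; exists (g \o f); apply: bij_comp. Qed.

(** A surjection is a quotient map: this is the universal property of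
    [quotmod] without reference to a particular model of the quotient. *)
Lemma factor_surjection U V W (p : {linear U -> V}) (f : {linear U -> W}) :
  surjective_map p -> (forall x, p x = 0 -> f x = 0) ->
  exists g : {linear V -> W}, forall x, g (p x) = f x.
Proof.
move=> /choice[s ps] pf.
have fs x : f (s (p x)) = f x.
  apply/eqP; rewrite -subr_eq0 -linearB; apply/eqP/pf.
  by rewrite linearB ps subrr.
have lin : linear (fun y => f (s y)).
  by move=> a x y; rewrite -[in LHS](ps x) -[in LHS](ps y) -linearP fs linearP.
by exists (mklinear lin).
Qed.

(** First isomorphism theorem, in symmetric form: two quotients of one module by
    the same submodule are isomorphic.  With [U] the ring it identifies the cyclic
    modules below with [k] and with the quotient by the socle. *)
Lemma same_kernel_iso U V W (p : {linear U -> V}) (q : {linear U -> W}) :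
  surjective_map p -> surjective_map q ->
  (forall x, p x = 0 <-> q x = 0) ->
  exists2 g : {linear V -> W}, bijective g & forall x, g (p x) = q x.
Proof.
move=> ps qs pq.
have [g gp] := factor_surjection ps (fun x => proj1 (pq x)).
exists g => //; apply: inj_surj_bijective.
  by apply: lin_injP => y; have [x <-] := ps y; rewrite gp => /pq.
by move=> z; have [x <-] := qs z; exists (p x).
Qed.

Lemma finitely_generated_surj U V (f : {linear U -> V}) :
  surjective_map f -> finitely_generated U -> finitely_generated V.
Proof.
move=> fs [n [e eU]]; exists n, (fun i => f (e i)) => y.
have [x <-] := fs y; have [c ->] := eU x; exists c.
by rewrite linear_sum; apply: eq_bigr => i _; rewrite linearZ.
Qed.

Lemma finitely_generated_regular : finitely_generated R^o.
Proof.
exists 1%N, (fun _ => 1) => x; exists (fun _ => x).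
by rewrite big_ord1 /GRing.scale /= mulr1.
Qed.

Lemma finitely_generated_prod U V :
  finitely_generated U -> finitely_generated V ->
  finitely_generated (U * V)%type.
Proof.
move=> [n [e eU]] [p [d dV]].
exists (n + p)%N, (fun i => match split i with
  inl j => (e j, 0) | inr j => (0, d j) end) => -[u v].
have [a ->] := eU u; have [b ->] := dV v.
exists (fun i => match split i with inl j => a j | inr j => b j end).
rewrite big_split_ord /=.
pose iU x : U * V := (x, 0); pose iV y : U * V := (0, y).
have lU : linear iU.
  by move=> c x y; rewrite -[RHS]/(_, c *: 0 + 0) scaler0 addr0.
have lV : linear iV.
  by move=> c x y; rewrite -[RHS]/(c *: 0 + 0, _) scaler0 addr0.
transitivity (iU (\sum_i a i *: e i) + iV (\sum_i b i *: d i)).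
  by rewrite -[RHS]/(_ + 0, 0 + _) addr0 add0r.
rewrite -[iU _]/(mklinear lU _) -[iV _]/(mklinear lV _) !linear_sum.
congr (_ + _); apply: eq_bigr => i _; rewrite linearZ //=.
  by rewrite -[lshift _ _]/(unsplit (inl i)) unsplitK.
by rewrite -[rshift _ _]/(unsplit (inr i)) unsplitK.
Qed.

End LinearMaps.

(** * Maximal ideals and the lemma of Nakayama *)

Section Local.
Variable R : comNzRingType.

(** Zorn's lemma; a chain is bounded by its union, to which [I] itself is added
    so that the empty chain is covered too. *)
Lemma proper_sub_maximal (I : submodClosed R^o) :
  1 \notin I -> exists2 J : submodClosed R^o,
    maximal_ideal J & {subset I <= J}.
Proof.
move=> I1.
pose T := {J : submodClosed R^o | 1 \notin J /\ {subset I <= J}}.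
pose leT (A B : T) := `[< {subset sval A <= sval B} >].
pose I0 : T := exist _ I (conj I1 (fun=> id)).
have [||A chain|[J [J1 IJ]] maxJ] := @ZL_preorder T I0 leT.
- by move=> A; apply/asboolP => x.
- by move=> A B C /asboolP BA /asboolP AC; apply/asboolP => x /BA /AC.
- pose P x := x \in I \/ exists2 B : T, A B & x \in sval B.
  have P0 : P 0 by left; exact: rpred0.
  have PD a x y : P x -> P y -> P (a *: x + y).
    move=> [xI|[B AB xB]] [yI|[C AC yC]].
    + by left; rewrite rpredD ?rpredZ.
    + right; exists C => //; rewrite rpredD ?rpredZ //.
      by apply: (proj2 (svalP C)).
    + right; exists B => //; rewrite rpredD ?rpredZ //.
      by apply: (proj2 (svalP B)).
    + right; have [/asboolP BC|/asboolP CB] := chain B C AB AC.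
        by exists C => //; rewrite rpredD ?rpredZ //; apply: BC.
      by exists B => //; rewrite rpredD ?rpredZ //; apply: CB.
  have U1 : 1 \notin mksubmod P0 PD.
    apply/mksubmodE => -[|[B _]]; first exact/negP.
    exact/negP/(proj1 (svalP B)).
  have IU : {subset I <= mksubmod P0 PD} by move=> x xI; apply/mksubmodE; left.
  exists (exist _ (mksubmod P0 PD) (conj U1 IU)) => B AB.
  by apply/asboolP => x xB; apply/mksubmodE; right; exists B.
exists J => //; split=> // K K1 JK x.
have IK : {subset I <= K} by move=> y /IJ /JK.
apply/idP/idP; last exact: JK.
have /asboolP := maxJ (exist _ K (conj K1 IK)) (asboolT JK).
exact.
Qed.

Variable m : submodClosed R^o.
Hypothesis mP : unique_maximal_ideal m.

Lemma one_notin_max : 1 \notin m.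
Proof. by case: mP => -[]. Qed.

(** If [x] had no inverse, the ideal that it generates would be proper, hence
    contained in a maximal ideal, and [m] is the only one. *)
Lemma notin_max_unit x : x \notin m -> exists y, y * x = 1.
Proof.
move=> xm; apply: contrapT => noinv.
have [|J /(proj2 mP) Jm xJ] := @proper_sub_maximal (range_mod (scale_by (x : R^o))).
  by apply/range_modP => -[y xy]; apply: noinv; exists y.
move/negP: xm; apply; rewrite -Jm; apply: xJ.
by apply/range_modP; exists 1; rewrite /= scale1r.
Qed.

Lemma mulr_in_max a x : x \in m -> a * x \in m.
Proof. exact: rpredZ. Qed.

Lemma mulm_in_max x a : x \in m -> x * a \in m.
Proof. by rewrite mulrC; exact: mulr_in_max. Qed.

Lemma oppr_in_max x : x \in m -> - x \in m.
Proof. by rewrite -mulN1r; exact: mulr_in_max. Qed.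

Lemma notin_max_cancel (V : lmodType R) d (v : V) :
  d \notin m -> d *: v = 0 -> v = 0.
Proof.
by move=> /notin_max_unit[y yd] dv; rewrite -[v]scale1r -yd -scalerA dv scaler0.
Qed.

Lemma one_sub_notin_max d : d \in m -> 1 - d \notin m.
Proof.
move=> dm; apply: contra one_notin_max => h.
by rewrite -[1](subrK d) (rpredD h).
Qed.

(** The determinant is a polynomial in the entries, so congruent matrices have
    congruent determinants, and here the determinant is congruent to 1. *)
Lemma det_one_sub_notin_max n (A : 'M[R]_n) :
  (forall i j, A i j \in m) -> \det (1%:M - A) \notin m.
Proof.
move=> Am; pose cg (x y : R) : Prop := x - y \in m.
have cgD x1 x2 y1 y2 : cg x1 x2 -> cg y1 y2 -> cg (x1 + y1) (x2 + y2).
  by move=> hx hy; rewrite /cg opprD addrACA; exact: rpredD hx hy.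
have cgM x1 x2 y1 y2 : cg x1 x2 -> cg y1 y2 -> cg (x1 * y1) (x2 * y2).
  move=> hx hy; rewrite /cg.
  have -> : x1 * y1 - x2 * y2 = (x1 - x2) * y1 + x2 * (y1 - y2).
    by rewrite mulrBl mulrBr addrA subrK.
  by apply: rpredD; [exact: mulm_in_max|exact: mulr_in_max].
have cgr x : cg x x by rewrite /cg subrr; exact: (rpred0 m).
have h : cg (\det (1%:M - A)) (\det (1%:M : 'M[R]_n)).
  rewrite /determinant; apply: (big_ind2 cg) => // s _; apply: (cgM); first exact: cgr.
  apply: (big_ind2 cg (cgr 1) cgM) => i _.
  by rewrite /cg !mxE addrAC subrr add0r; exact: oppr_in_max.
move: h => /oppr_in_max; rewrite det1 opprB => h.
apply: contra one_notin_max => hd.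
by rewrite -[1](subrK (\det (1%:M - A))) (rpredD h hd).
Qed.

(** The generators are congruent modulo [N] to combinations of themselves with
    coefficients [A] in [m].  So [1 - A] carries them into [N], and its adjugate
    shows that its determinant, a unit, does so too. *)
Lemma nakayama (V : lmodType R) n (e : 'I_n -> V) (N : submodClosed V) :
  (forall i, exists2 c : 'I_n -> R,
     forall j, c j \in m & e i - \sum_j c j *: e j \in N) ->
  forall i, e i \in N.
Proof.
move=> h; have /choice[c hc] : forall i, exists c : 'I_n -> R,
  (forall j, c j \in m) /\ e i - \sum_j c j *: e j \in N.
  by move=> i; have [c] := h i; exists c.
pose A := \matrix_(i, j) c i j; pose B : 'M[R]_n := 1%:M - A.
have /notin_max_unit[u uB] : \det B \notin m.
  by apply: det_one_sub_notin_max => i j; rewrite mxE; case: (hc i).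
have BN k : \sum_j B k j *: e j \in N.
  have [_] := hc k; congr (_ \in N).
  rewrite [RHS](eq_bigr (fun j => (k == j)%:R *: e j - c k j *: e j)); last first.
    by move=> j _; rewrite !mxE scalerBl.
  rewrite sumrB; congr (_ - _); rewrite (bigD1 k) //= eqxx scale1r.
  by rewrite big1 ?addr0 // => j jk; rewrite eq_sym (negbTE jk) scale0r.
move=> i; rewrite -[e i]scale1r -uB -scalerA rpredZ //.
suff -> : \det B *: e i = \sum_k (\adj B) i k *: \sum_j B k j *: e j.
  by apply: rpred_sum => k _; rewrite rpredZ.
under eq_bigr do rewrite scaler_sumr; rewrite exchange_big /=.
have Bij j : \sum_k (\adj B) i k *: (B k j *: e j) = (\det B *+ (i == j)) *: e j.
  under eq_bigr do rewrite scalerA.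
  by rewrite -scaler_suml; have /matrixP/(_ i j) := mul_adj_mx B; rewrite 2!mxE => ->.
rewrite (eq_bigr _ (fun j _ => Bij j)) (bigD1 i) //= eqxx big1 ?addr0 // => j ji.
by rewrite eq_sym (negbTE ji) scale0r.
Qed.

End Local.

(** * The kernel of an irreducible epimorphism from a free module *)

Section Irreducible.
Variables (R : comNzRingType) (m : submodClosed R^o).
Hypothesis mP : unique_maximal_ideal m.
Implicit Types F M L : lmodType R.

(** If [lam x] were a unit, [F] would be the direct sum of [R x] and the kernel
    of [lam], and as [phi] kills [x] it would factor through the projection [g0]
    onto the latter.  The projection kills [x], so it is not a split
    monomorphism, and a section of the other factor is a section of [phi]. *)
Lemma functional_on_kernel_in_max F M (phi : {linear F -> M}) (lam : {linear F -> R^o}) x :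
  finitely_generated F -> irreducible phi -> phi x = 0 -> lam x \in m.
Proof.
move=> Ffg [_ nepi irr] phix; case: (boolP (lam x \in m)) => // lx.
have [u ux] := notin_max_unit mP lx.
pose g0 : {linear F -> F} := idfun \- (scale_by x \o (u \*: lam)).
have g0E y : g0 y = y - (u * lam y) *: x by [].
have g0L y : g0 y \in kermod lam.
  apply/kermodP; rewrite g0E linearB linearZ /= /GRing.scale /=.
  by rewrite mulrAC ux mul1r subrr.
have gs : surjective_map (corestrict g0L).
  move=> [z zL]; exists z; apply: val_inj; rewrite -[LHS]/(g0 z).
  by rewrite g0E (elimT (kermodP _ _) zL) mulr0 scale0r subr0.
have phig : phi =1 (phi \o val) \o corestrict g0L.
  by move=> y; rewrite -[RHS]/(phi (g0 y)) g0E linearB linearZ /= phix scaler0 subr0.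
have [|[r gr]|[s hs]] := irr _ _ _ _ phig.
- exact: finitely_generated_surj gs Ffg.
- have gx : corestrict g0L x = 0.
    by apply: val_inj; rewrite -[LHS]/(g0 x) g0E ux scale1r subrr.
  by move/negP: lx; case; rewrite -[x]gr gx !linear0 rpred0.
- by case: nepi; exists (val \o s).
Qed.

Lemma freeg_coeff_linear (I : choiceType) (i : I) :
  linear (fun D : {freeg I / R} => coeff i D : R^o).
Proof. by move=> a D E; rewrite coeffD coeffZ. Qed.

(** On a free module the functionals detect [m F], because the coordinates of
    [x] in a basis are functionals.  The basis is then expressed by the finitely
    many generators [e], and may itself be infinite a priori. *)
Lemma free_functionals_in_max F n (e : 'I_n -> F) x :
  free_module F -> (forall y, exists c : 'I_n -> R, y = \sum_i c i *: e i) ->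
  (forall lam : {linear F -> R^o}, lam x \in m) ->
  exists2 c : 'I_n -> R, forall i, c i \in m & x = \sum_i c i *: e i.
Proof.
move=> [I [f [g fK gK]]] eF lx.
have /choice[d dE] i := eF (g << i >>).
exists (fun j => \sum_(i <- dom (f x)) coeff i (f x) * d i j) => [j|].
  elim/big_ind: _ => [|y z ym zm|i _]; first exact: (rpred0 m).
    exact: rpredD ym zm.
  apply: mulm_in_max.
  exact: (lx (mklinear (freeg_coeff_linear i) \o f)).
rewrite -[LHS]fK -[f x in LHS]freeg_sumE.
have -> : \sum_(i <- dom (f x)) << coeff i (f x) *g i >> =
  \sum_(i <- dom (f x)) coeff i (f x) *: << i >>.
  apply: eq_bigr => i _; apply/eqP/freeg_eqP => k.
  by rewrite coeffZ !coeffU mul1r.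
rewrite -[g _]/(mklinear (inv_is_linear fK gK) _) linear_sum.
under [RHS]eq_bigr do rewrite scaler_suml.
rewrite exchange_big; apply: eq_bigr => i _.
rewrite linearZ /= dE scaler_sumr; apply: eq_bigr => j _; by rewrite scalerA.
Qed.

(** The hypothesis on [N] says that [N] and the kernel together span [F].  The
    kernel lies in [m F], so Nakayama applies to [N]. *)
Lemma kernel_superfluous F M (phi : {linear F -> M}) (N : submodClosed F) :
  finitely_generated F -> free_module F -> irreducible phi ->
  (forall x, exists2 y, y \in N & phi y = phi x) -> forall x, x \in N.
Proof.
move=> Ffg Ffree irr NK; have [n [e eF]] := Ffg.
have eN : forall i, e i \in N.
  apply: (nakayama mP) => i; have [w wN pw] := NK (e i).
  have [|c cm ew] := @free_functionals_in_max F n e (e i - w) Ffree eF.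
    move=> lam; apply: functional_on_kernel_in_max irr _ => //.
    by rewrite linearB pw subrr.
  by exists c => //; rewrite -ew opprB addrC subrK.
by move=> x; have [c ->] := eF x; apply: rpred_sum => i _; rewrite rpredZ.
Qed.

(** With [h : F / S -> M] induced by [phi] and [s] a section of [h], the maps
    [quotproj S] and [s \o phi] agree on a submodule [N] of [F].  It meets every
    class modulo the kernel, since a lift [w] of [s (phi y)] belongs to it, so it
    is all of [F]. *)
Lemma kernel_no_proper_submod F M (phi : {linear F -> M}) (S : submodClosed F) a :
  finitely_generated F -> free_module F -> irreducible phi ->
  surjective_map phi ->
  {subset S <= kermod phi} -> a \in S -> a != 0 -> {subset kermod phi <= S}.
Proof.
move=> Ffg Ffree irr phis Sker aS a0 x /kermodP phix.
have [_ _ fac] := irr.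
have [h hE] : exists h : {linear quotmod S -> M}, forall x, h (quotproj S x) = phi x.
  apply: factor_surjection => [|y /quotproj_eq0 /Sker /kermodP //].
  exact: quotproj_surj.
have [||[r rK]|[s sK]] := fac _ (quotproj S) h.
- exact: finitely_generated_surj (@quotproj_surj _ _ S) Ffg.
- by move=> y; rewrite /= hE.
- move: a0; rewrite -(rK a); move/quotproj_eq0: aS => /= ->.
  by rewrite linear0 eqxx.
pose N : submodClosed F := kermod (quotproj S \- (s \o phi)).
have NE y : y \in N = (quotproj S y == s (phi y)) by rewrite kermodE /= subr_eq0.
suff /(_ x) : forall y, y \in N.
  by rewrite NE phix linear0 => /eqP /quotproj_eq0.
apply: kernel_superfluous irr _ => // y.
have [w wE] := quotproj_surj (s (phi y)).
have pw : phi w = phi y by rewrite -hE wE sK.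
by exists w => //; rewrite NE pw wE.
Qed.

Lemma irreducible_epi_kernel_neq0 F M (phi : {linear F -> M}) :
  irreducible phi -> surjective_map phi ->
  exists2 a, phi a = 0 & a != 0.
Proof.
move=> [nmono _ _] phis; apply: contrapT => no.
have phiI : injective phi.
  apply: lin_injP => x phix; apply/eqP/negPn/negP => x0.
  by apply: no; exists x.
have [g fK gK] := inj_surj_bijective phiI phis.
by case: nmono; exists (mklinear (inv_is_linear fK gK)).
Qed.

(** Every nonzero element of the kernel generates it.  So if [r] in [m] did not
    kill [a], then [a] would be a multiple [s r a] of [r a], although [1 - s r] is
    a unit. *)
Lemma simple_kernel_generator F M (phi : {linear F -> M}) :
  finitely_generated F -> free_module F -> irreducible phi ->
  surjective_map phi ->
  exists a, [/\ phi a = 0, a != 0, forall x, phi x = 0 -> exists r : R, x = r *: a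
    & forall r : R, r *: a = 0 <-> r \in m].
Proof.
move=> Ffg Ffree irr phis.
have [a pa a0] := irreducible_epi_kernel_neq0 irr phis.
have gen b : phi b = 0 -> b != 0 -> forall x, phi x = 0 -> exists r : R, x = r *: b.
  move=> pb b0 x px.
  suff /(_ x) : {subset kermod phi <= range_mod (scale_by b)}.
    by case/(_ (introT (kermodP _ _) px))/range_modP => r <-; exists r.
  apply: (@kernel_no_proper_submod _ _ _ _ b) irr _ _ _ _ => //.
    move=> _ /range_modP[r <-]; apply/kermodP.
    by rewrite linearZ /= pb scaler0.
  by apply/range_modP; exists 1; rewrite /= scale1r.
exists a; split=> // [|r]; first exact: gen.
split=> [ra|rm]; apply/eqP.
  case: (boolP (r \in m)) => // /notin_max_cancel /(_ ra).
  by move/(_ mP)/eqP; rewrite (negbTE a0).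
apply/negPn/negP => ra0.
have [|s sa] := gen (r *: a) _ ra0 a pa; first by rewrite linearZ /= pa scaler0.
have /(notin_max_cancel mP) a00 := one_sub_notin_max mP (mulr_in_max s rm).
by case/eqP: a0; apply: a00; rewrite scalerBl scale1r -scalerA -sa subrr.
Qed.

Lemma irreducible_epi_kernel F M (phi : {linear F -> M}) :
  finitely_generated F -> free_module F -> irreducible phi ->
  surjective_map phi ->
  isomorphic (submod (kermod phi)) (residue_field m).
Proof.
move=> Ffg Ffree irr phis.
have [a [pa a0 gen anna]] := simple_kernel_generator Ffg Ffree irr phis.
have aK r : scale_by a r \in kermod phi.
  by apply/kermodP; rewrite linearZ /= pa scaler0.
have [||r|g gb _] := @same_kernel_iso _ _ _ _ (corestrict aK) (quotproj m).
- move=> [x xK]; have [r xr] := gen x (elimT (kermodP _ _) xK).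
  by exists r; apply: val_inj.
- exact: quotproj_surj.
- rewrite quotproj_eq0 -anna; split=> [ra|ra]; last exact: val_inj.
  exact: (congr1 val ra).
by exists g.
Qed.
End Irreducible.

(** * Restriction to a summand when the target has local endomorphism ring *)

Section Restrict.
Variable R : comNzRingType.
Implicit Types U F M L : lmodType R.

Lemma local_ring_add1 (A : pzRingType) (x y : A) :
  local_ring A -> x + y = 1 -> is_unit x \/ is_unit y.
Proof.
move=> [_ closedB ideal] xy1; apply: contrapT => /not_orP[nx ny].
have [nNy _] := ideal (-1) y ny.
apply: (closedB _ _ nx nNy); rewrite mulN1r opprK xy1.
by exists 1; rewrite mulr1.
Qed.

Lemma endo_unitP M (f : endo M) : is_unit f ->
  exists g : {linear M -> M}, cancel g f /\ cancel f g.
Proof.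
move=> [g [fg gf]]; exists g; split=> x.
  exact: (congr1 (fun h : {linear M -> M} => h x) fg).
exact: (congr1 (fun h : {linear M -> M} => h x) gf).
Qed.

(** If [phi \o iota] had a retraction [t], then [e = phi iota t] or [1 - e] would
    be a unit; the first makes [phi] a split epimorphism, the second vanishes on
    the image of the injective map [phi iota] and forces [U] to be zero.  For a factorization [h \o g] of
    [phi \o iota], the map [phi] factors through [L * F] as [x |-> (g (r x), p x)]
    followed by [(l, y) |-> h l + phi (p y)], where [p] is the projection of [F]
    onto the kernel of the retraction [r] of [iota]. *)
Lemma irreducible_restrict_summand U F M (phi : {linear F -> M}) (iota : {linear U -> F}) :
  local_ring (endo M) -> (exists u : U, u != 0) -> finitely_generated F ->
  split_mono iota -> irreducible phi -> irreducible (phi \o iota).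
Proof.
move=> locM [u0 u0N] Ffg [r rK] [_ nepi fac]; split.
- move=> [t tK].
  pose e : endo M := (phi \o iota) \o t.
  have [|/endo_unitP[y [ye ey]]|/endo_unitP[y [ye ey]]] :=
    @local_ring_add1 (endo M) e (1 - e) locM; first by rewrite addrC subrK.
    by case: nepi; exists (iota \o (t \o y)); exact: ye.
  case/eqP: u0N; rewrite -[u0]tK; rewrite -[X in t X]ey.
  have -> : (1 - e : {linear M -> M}) ((phi \o iota) u0) = 0.
    rewrite -[LHS]/(_ - e ((phi \o iota) u0)) /e /=.
    by rewrite -[X in t X]/((phi \o iota) u0) tK subrr.
  by rewrite !linear0.
- move=> [s sK]; case: nepi; exists (iota \o s); exact: sK.
move=> L g h Lfg hg.
pose p : {linear F -> F} := idfun \- (iota \o r).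
have pE x : p x = x - iota (r x) by [].
have piota x : p (iota x) = 0 by rewrite pE rK subrr.
have rp x : r (p x) = 0 by rewrite pE linearB rK subrr.
have pp x : p (p x) = p x by rewrite [LHS]pE rp linear0 subr0.
have lG : linear (fun x => (g (r x), p x)) by move=> a x y; rewrite !linearP.
pose H : {linear (L * F)%type -> M} := (h \o fst) \+ (phi \o (p \o snd)).
have [||[t tK]|[s sK]] := fac _ (mklinear lG) H.
- exact: finitely_generated_prod.
- move=> x; rewrite -[RHS]/((h \o g) (r x) + phi (p (p x))) -hg pp pE.
  by rewrite linearB addrC subrK.
- left; have lt : linear (fun l => r (t (l, 0))).
    move=> a x y; rewrite -!linearP; congr (r (t _)).
    by rewrite -[RHS]/(_, a *: 0 + 0) scaler0 addr0.
  exists (mklinear lt) => x; have := tK (iota x).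
  rewrite -[mklinear lG _]/(g (r (iota x)), p (iota x)) rK piota => tx.
  by rewrite -[LHS]/(r (t (g x, 0))) tx rK.
pose f1 : endo M := h \o (fst \o s); pose f2 : endo M := phi \o (p \o (snd \o s)).
have [|/endo_unitP[y [ye _]]|/endo_unitP[y [ye _]]] :=
    @local_ring_add1 (endo M) f1 f2 locM.
- by apply: hom_ext => x; exact: sK.
- by right; exists ((fst \o s) \o y); exact: ye.
- by case: nepi; exists ((p \o (snd \o s)) \o y); exact: ye.
Qed.

Lemma irreducible_surj_or_inj F M (f : {linear F -> M}) :
  finitely_generated F -> irreducible f -> surjective_map f \/ injective f.
Proof.
move=> Ffg [_ _ fac].
have fR x : f x \in range_mod f by apply/range_modP; exists x.
have [|//|[r rK]|[s sK]] := fac _ (corestrict fR) val.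
- apply: (finitely_generated_surj (f := corestrict fR)) Ffg => -[y yR].
  by have /range_modP[x xy] := yR; exists x; apply: val_inj; exact: xy.
- right => x y fxy; rewrite -[x]rK -[y]rK; congr (r _); exact: val_inj.
- left => y; have /range_modP[x xy] := valP (s y).
  by exists x; rewrite xy; exact: sK.
Qed.

End Restrict.

(** * The socle, the depth and the type *)

Section Socle.
Variables (R : comNzRingType) (m : submodClosed R^o).
Hypothesis mP : unique_maximal_ideal m.
Implicit Types M : lmodType R.

Lemma SocP x : reflect (forall c : R, c \in m -> c * x = 0) (x \in Soc m).
Proof. exact: asboolP. Qed.

(** [psi] factors through the pushout of [R] and [R] along [a] and [x], namely
    the quotient of [R * R] by the line spanned by [(a, - x)].  A retraction of
    the inclusion of the first factor writes [a] as [u * x], where [u] cannot be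
    in [m] since [m] kills [x].  A section of the map to [M] sends [psi 1] to the
    class of some [(u, v)] with [u - 1] in the kernel; as [a] kills [psi 1], the
    vector [(a * u, a * v)] is a multiple [d] of [(a, - x)], and [d] is a
    unit because [a * u = a]. *)
Lemma socle_sub_kernel M (psi : {linear R^o -> M}) (a : R) :
  irreducible psi -> surjective_map psi -> a != 0 -> a \in Soc m ->
  (forall x, psi x = 0 -> exists r : R, x = r * a) -> psi a = 0 ->
  forall x, x \in Soc m -> exists r : R, x = r * a.
Proof.
move=> [_ _ fac] psis a0 aS gen pa x xS.
(* If a is a unit, everything is a multiple of it. *)
case: (boolP (a \in m)) => [am|/(notin_max_unit mP)[v va]]; last first.
  by exists (x * v); rewrite -mulrA va mulr1.
pose S : submodClosed (R^o * R^o)%type :=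
  range_mod (scale_by ((a, - x) : (R^o * R^o)%type)).
have SP (u v : R) : (u, v) \in S -> exists d, u = d * a /\ v = - (d * x).
  by move=> /range_modP[d [<- <-]]; exists d; rewrite -mulrN.
have lg : linear (fun r : R^o => (r, 0) : (R^o * R^o)%type).
  by move=> c u v; rewrite -[RHS]/(_, c *: 0 + 0) scaler0 addr0.
pose g : {linear R^o -> quotmod S} := quotproj S \o mklinear lg.
have [h hE] : exists h : {linear quotmod S -> M},
    forall z, h (quotproj S z) = (psi \o fst) z.
  apply: factor_surjection => [|[u v] /quotproj_eq0 /SP[d [-> _]]].
    exact: quotproj_surj.
  by rewrite /= -[d * a]/(d *: (a : R^o)) linearZ /= pa scaler0.
have [||[t tK]|[s sK]] := fac _ g h.
- apply: (finitely_generated_surj (@quotproj_surj _ _ S)).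
  by apply: finitely_generated_prod; exact: finitely_generated_regular.
- by move=> r; rewrite /= hE.
- pose u : R := t (quotproj S (0, 1)).
  have aux : a = u * x.
    have q0 : quotproj S (a, - x) = 0.
      by apply/quotproj_eq0/range_modP; exists 1; exact: scale1r.
    have : t (quotproj S (a, - x)) = 0 by rewrite q0 linear0.
    have -> : (a, - x) = mklinear lg a + (- x) *: (0, 1) :> (R^o * R^o)%type.
      rewrite -[RHS]/(a + - x * 0, 0 + - x * 1).
      by rewrite mulr0 addr0 add0r mulr1.
    rewrite !linearD !linearZ /= -/(g a) tK -/u /GRing.scale /= mulNr.
    by move/eqP; rewrite subr_eq0 mulrC => /eqP.
  have /(notin_max_unit mP)[v vu] : u \notin m.
    apply: contra a0 => um; rewrite aux; apply/eqP; exact: (SocP _ xS).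
  by exists v; rewrite aux mulrA vu mul1r.
have [[u v] wE] := quotproj_surj (s (psi 1)).
have [c uc] : exists c, u - 1 = c * a.
  by apply: gen; rewrite linearB -[psi u]/((psi \o fst) (u, v)) -hE wE sK subrr.
have aw : a *: (quotproj S (u, v)) = 0.
  by rewrite wE -!linearZ /= -[a *: 1]/(a * 1) mulr1 pa linear0.
have [d [da dx]] : exists d, a * u = d * a /\ a * v = - (d * x).
  by apply/SP/(proj1 (quotproj_eq0 S _)); rewrite -aw -linearZ.
(* u - 1 is a multiple of a, and a * a = 0 since a is in m. *)
have aa : a * (u - 1) = 0.
  by rewrite uc mulrCA (SocP _ aS) // mulr0.
have dm : d \notin m.
  apply: contra a0 => dm; rewrite -[a]mulr1 -[1](subrK u) mulrDr -(mulrC u).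
  rewrite -opprB mulrN aa oppr0 add0r mulrC da.
  by apply/eqP; exact: (SocP _ aS).
have [w wd] := notin_max_unit mP dm.
exists (- (w * v)); rewrite mulNr -mulrA [v * a]mulrC dx mulrN opprK.
by rewrite mulrA wd mul1r.
Qed.

Section TypeOne.
Variable a : R^o.
Hypotheses (a0 : a != 0) (anna : forall r : R, r *: a = 0 <-> r \in m).
Hypothesis Soca : forall x, x \in Soc m -> exists r : R, x = r *: a.

(** The first term of a regular sequence in [m] would kill [a]. *)
Lemma has_depth0 : has_depth m 0.
Proof.
split.
  exists [::]; split=> //; split=> // -[c]; rewrite big_ord0.
  by move/eqP; rewrite oner_eq0.
case=> // b s sm [_ /(_ 0%N isT a) h].
have []: in_ideal [::] a.
  apply: h; exists (fun=> 0); rewrite big_ord0; apply/anna.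
  by apply: sm; rewrite mem_head.
by move=> c; rewrite big_ord0 => /eqP; rewrite (negbTE a0).
Qed.

(** A 0-cocycle is a map from the free module on [k] that vanishes on relations,
    that is, a map [k -> R]; it is determined by the image of 1, which is a socle
    element and so a multiple [r a].  Thus [r |-> r a] induces a surjection [p]
    from [R] onto [Ext^0(k, R)] whose kernel, like that of [R -> k], is [m]. *)
Lemma Ext0_residue_field :
  has_residue_dim m (Ext (residue_field m) R^o 0) 1.
Proof.
set k := residue_field m.
have [al alE] : exists al : {linear k -> R^o},
    forall r, al (quotproj m r) = scale_by a r.
  apply: factor_surjection => [|r /quotproj_eq0]; last by move/anna.
  exact: quotproj_surj.
pose C := scale_by (al \o @augm R k : {linear free_res k 0 -> R^o}).
have CE r D : C r D = r * al (augm D) by [].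
have CK r : C r \in kermod (@codiff R k R^o 0).
  apply/kermodP/hom_ext => D; rewrite -[LHS]/(C r (free_res_diff k 0 D)) CE.
  have -> : augm (free_res_diff k 0 D) = 0 by apply/augm_exact; exists D.
  by rewrite linear0 mulr0.
pose p : {linear R^o -> Ext k R^o 0} :=
  quotproj (coboundary k R^o 0) \o corestrict CK.
have lq : linear (fun r : R^o => [ffun _ : 'I_1 => quotproj m r]).
  by move=> c r s; apply/ffunP => i; rewrite !ffunE linearP.
have ps : surjective_map p.
  move=> y; have [[f fK] <-] := quotproj_surj y.
  have fd := congr1 (fun h : {linear _ -> _} => h _) (elimT (kermodP _ _) fK).
  have [fb fbE] : exists fb : {linear k -> R^o}, forall D, fb (augm D) = f D.
    apply: factor_surjection => [|D /augm_exact[E <-]]; first exact: augm_surj.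
    exact: fd.
  have [r rE] : exists r : R, fb (quotproj m 1) = r *: a.
    apply/Soca/SocP => c cm.
    rewrite -[_ * _]/(c *: (fb _ : R^o)) -!linearZ /=.
    have -> : quotproj m (c *: 1) = 0.
      by apply/quotproj_eq0; rewrite -[c *: 1]/(c * 1) mulr1.
    by rewrite linear0.
  exists r; rewrite /p /=; congr (quotproj _ _); apply: val_inj => /=.
  apply: hom_ext => D; rewrite -[LHS]/(C r D) CE -fbE.
  have [s <-] := quotproj_surj (augm D); rewrite alE /=.
  rewrite -[s in RHS]mulr1 -[s * 1]/(s *: (1 : R^o)) !linearZ /= rE.
  by rewrite /GRing.scale /= mulrCA.
have qs : surjective_map (mklinear lq).
  move=> y; have [r rE] := quotproj_surj (y ord0); exists r.
  by apply/ffunP => i; rewrite ffunE rE (ord1 i).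
have [r|g gb _] := same_kernel_iso ps qs; last by exists g.
have -> : p r = 0 <-> r \in m.
  rewrite quotproj_eq0 -anna; split=> [/eqP /(congr1 val) Cr0|ra].
    have : C r << quotproj m 1 >> = 0 by rewrite -[C r]/(val (corestrict CK r)) Cr0.
    by rewrite CE augmU scale1r alE /= scale1r.
  apply/eqP/val_inj/hom_ext => D; rewrite -[LHS]/(C r D) CE.
  have [s <-] := quotproj_surj (augm D); rewrite alE /=.
  by rewrite -[_ *: a]/(s * a) mulrCA -[r * a]/(r *: a) ra mulr0.
rewrite -quotproj_eq0; split=> [rm|/ffunP/(_ ord0)]; last by rewrite !ffunE.
by apply/ffunP => i; rewrite !ffunE.
Qed.

Lemma has_type1 : has_type m 1.
Proof. by exists 0%N; split; [exact: has_depth0|exact: Ext0_residue_field]. Qed.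
End TypeOne.
End Socle.

Lemma regular_row_iso (R : comNzRingType) : isomorphic R^o 'rV[R]_1.
Proof.
have lin : linear (fun r : R^o => \row_(j < 1) r : 'rV[R]_1).
  by move=> c r s; apply/rowP => j; rewrite !mxE.
exists (mklinear lin), (fun v : 'rV[R]_1 => v 0 0) => [r|v]; first by rewrite mxE.
by apply/rowP => j; rewrite mxE (ord1 j).
Qed.

Theorem theorem2 (R : comNzRingType) (m : submodClosed R^o)
    (F M : lmodType R) (phi : {linear F -> M}) :
  noetherian_local m ->
  finitely_generated F -> finitely_generated M -> free_module F ->
  irreducible phi -> surjective_map phi ->
  isomorphic (submod (kermod phi)) (residue_field m) /\
  (local_ring (endo M) ->
   forall iota : {linear R^o -> F}, split_mono iota ->
   (irreducible (phi \o iota) /\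
    (surjective_map (phi \o iota) \/ injective (phi \o iota))) /\
   (surjective_map (phi \o iota) ->
    [/\ has_type m 1, free_of_rank F 1
      & exists rho : {linear quotmod (Soc m) -> M},
          [/\ phi \o iota =1 rho \o quotproj (Soc m),
              bijective iota & bijective rho]])).
Proof.
move=> [_ mP] Ffg Mfg Ffree irr phis; split.
  exact: irreducible_epi_kernel.
move=> locM iota siota; have [r rK] := siota.
have irr' : irreducible (phi \o iota).
  by apply: irreducible_restrict_summand => //; exists 1; exact: oner_neq0.
split.
  split=> //; apply: irreducible_surj_or_inj => //.
  exact: finitely_generated_regular.
move=> psis.
have iotas : surjective_map iota.
  move=> y; apply/range_modP; apply: (kernel_superfluous mP _ _ irr) => // x.
  have [u ux] := psis (phi x).
  by exists (iota u) => //; apply/range_modP; exists u.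
have iotab : bijective iota by apply: inj_surj_bijective => //; exact: can_inj rK.
have isoF : isomorphic R^o F by exists iota.
have Rfree : free_module R^o.
  by have [I FI] := Ffree; exists I; exact: isomorphic_trans isoF FI.
have [a [pa a0 gen anna]] :=
  simple_kernel_generator mP (finitely_generated_regular R) Rfree irr' psis.
have aS : a \in Soc m by apply/SocP => c /anna.
have Soca := socle_sub_kernel mP irr' psis a0 aS gen pa.
split.
- exact: has_type1 a0 anna Soca.
- exact: isomorphic_trans (isomorphic_sym isoF) (regular_row_iso R).
have [|rho rhob rhoE] := same_kernel_iso (@quotproj_surj _ _ (Soc m)) psis.
  move=> x; rewrite quotproj_eq0; split=> [/Soca[s ->]|/gen[s ->]].
    by rewrite -[s * a]/(s *: a) linearZ /= [phi _]pa scaler0.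
  exact: rpredZ.
by exists rho; split=> // x; rewrite /= rhoE.
Qed.
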